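(* Let $(\mathcal{M},0)$ be a pointed metric space, let $n\geq 1$ be an integer, let $\theta\in[0,2\pi)$, and let $(\{f_j\}_{j=1}^n,\{\tau_j\}_{j=1}^n)$ be an $(n,\theta)$-metric code in $\mathcal{M}$. Let $c>0$ and let $\phi:[-1,1]\to\mathbb{R}$ be a function satisfying the following two conditions: (i) $\sum_{j=1}^n\sum_{k=1}^n\phi(f_j(\tau_k))\geq 0$; (ii) $\phi(r)+c\leq 0$ for all $r$ with $-1\leq r\leq\cos\theta$. Then $$n\leq\frac{\phi(1)+c}{c}.$$ In particular, if $\phi(1)+c\leq 1$, then $n\leq 1/c$.
   Context: A pointed metric space $(\mathcal{M},0)$ is a metric space $\mathcal{M}$ with metric $m$ and a distinguished point $0\in\mathcal{M}$. $\operatorname{Lip}_0(\mathcal{M},\mathbb{R})$ denotes the set of Lipschitz functions $f:\mathcal{M}\to\mathbb{R}$ with $f(0)=0$, and for such $f$ the Lipschitz norm is $\|f\|_{\operatorname{Lip}_0}=\sup_{x,y\in\mathcal{M},\,x\neq y}\frac{|f(x)-f(y)|}{m(x,y)}$. Metric code: For $1\leq j\leq n$ let $f_j\in\operatorname{Lip}_0(\mathcal{M},\mathbb{R})$ and $\tau_j\in\mathcal{M}$. The pair $(\{f_j\}_{j=1}^n,\{\tau_j\}_{j=1}^n)$ is an $(n,\theta)$-metric code in $\mathcal{M}$ if: (i) $\|f_j\|_{\operatorname{Lip}_0}=1$ for all $1\leq j\leq n$; (ii) $m(\tau_j,0)=1$ for all $1\leq j\leq n$; (iii) $f_j(\tau_j)=1$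 for all $1\leq j\leq n$; (iv) $f_j(\tau_k)\leq\cos\theta$ for all $1\leq j,k\leq n$ with $j\neq k$. These conditions imply $f_j(\tau_k)\in[-1,1]$ for all $j,k$, so $\phi(f_j(\tau_k))$ is well defined. *)

(* Defs.v *)
From HB Require Import structures.
From mathcomp Require Import all_boot all_order all_algebra.
From mathcomp Require Import classical_sets reals topology trigo.

Set Implicit Arguments.
Unset Strict Implicit.
Unset Printing Implicit Defensive.

Import Order.TTheory GRing.Theory Num.Theory.

Local Open Scope classical_set_scope.
Local Open Scope ring_scope.

Definition Lip0 (R : realType) (M : metricType R) (o : M) : set (M -> R) :=
  [set f | (exists L : R, forall x y : M, `|f x - f y| <= L * mdist x y)
           /\ f o = 0].

(* [sup] is real-valued, with value 0 on sets that are empty or unbounded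
   above; it is the Lipschitz norm on [Lip0 o], where the set of slopes is
   bounded above, and 0 if [M] has a single point. *)
Definition Lip0_norm (R : realType) (M : metricType R) (f : M -> R) : R :=
  sup [set s : R | exists x y : M,
         x <> y /\ s = `|f x - f y| / mdist x y].

Record metric_code (R : realType) (M : metricType R) (o : M) (n : nat)
    (theta : R) (f : 'I_n -> M -> R) (tau : 'I_n -> M) : Prop := MetricCode {
  metric_code_Lip0 : forall j, Lip0 o (f j) ;
  metric_code_norm : forall j, Lip0_norm (f j) = 1 ;
  metric_code_dist : forall j, mdist (tau j) o = 1 ;
  metric_code_diag : forall j, f j (tau j) = 1 ;
  metric_code_offdiag : forall j k, j <> k -> f j (tau k) <= cos theta
}.

(* Main.v *)
Require Import Defs.
From HB Require Import structures.
From mathcomp Require Import all_boot all_order all_algebra.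
From mathcomp Require Import classical_sets reals topology trigo.

(** Summing [phi + c] over all pairs [(j, k)] gives at least [n ^ 2 * c], since
    the sum of [phi] alone is nonnegative. On the other hand each of the [n]
    diagonal pairs contributes exactly [phi 1 + c], and each off-diagonal pair
    contributes at most 0, because [-1 <= f j (tau k) <= cos theta].
    Hence [n ^ 2 * c <= n * (phi 1 + c)], and one divides by [n * c].

    The lower bound [-1 <= f j (tau k)] is the only place where the metric
    enters: [f j] vanishes at the base point and is 1-Lipschitz, while
    [tau k] lies on the unit sphere around the base point
    ([metric_code_ge_opp1]). *)

Set Implicit Arguments.
Unset Strict Implicit.
Unset Printing Implicit Defensive.

Import Order.TTheory GRing.Theory Num.Theory.

Local Open Scope ring_scope.

(** The norm is a real-valued supremum, so it dominates a slope only because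
    the Lipschitz constant [L] bounds the set of slopes; the case [x = y],
    where there is no slope, is trivial. *)
Lemma ler_Lip0_norm (R : realType) (M : metricType R) (o : M) (f : M -> R) :
  Lip0 o f -> forall x y : M, `|f x - f y| <= Lip0_norm f * mdist x y.
Proof.
move=> [[L fL] _] x y; have [->|/eqP xy] := eqVneq x y.
  by rewrite subrr normr0 mdistxx mulr0.
have mdist_pos (u v : M) : u <> v -> 0 < mdist u v.
  by move=> uv; rewrite mdist_gt0; apply/eqP.
rewrite -ler_pdivrMr ?mdist_pos//; apply: ub_le_sup; last by exists x, y.
by exists L => _ [u [v [uv ->]]]; rewrite ler_pdivrMr ?mdist_pos.
Qed.

Lemma metric_code_ge_opp1 (R : realType) (M : metricType R) (o : M) (n : nat)
    (theta : R) (f : 'I_n -> M -> R) (tau : 'I_n -> M) :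
  metric_code o theta f tau -> forall j k, -1 <= f j (tau k).
Proof.
move=> hcode j k; have fL := metric_code_Lip0 hcode j.
have := ler_Lip0_norm fL (tau k) o.
rewrite (metric_code_norm hcode) (metric_code_dist hcode) mul1r.
by case: fL => _ ->; rewrite subr0 ler_norml => /andP[].
Qed.

(** The counting argument, freed from the metric. After adding [c] to every
    entry, each row sum is at most its diagonal term [d + c], while the total
    has grown by [n ^ 2 * c]; comparing the totals of the [n] rows leaves one
    factor [n] to cancel. *)
Lemma sum_diag_dominated (R : realDomainType) (n : nat) (a : 'I_n -> 'I_n -> R)
    (c d : R) :
  (0 < n)%N -> 0 <= \sum_(j < n) \sum_(k < n) a j k ->
  (forall j, a j j = d) -> (forall j k, j != k -> a j k + c <= 0) ->
  n%:R * c <= d + c.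
Proof.
move=> n_gt0 sum_ge0 diag offdiag.
have row j : \sum_(k < n) a j k + n%:R * c <= d + c.
  have -> : n%:R * c = \sum_(k < n) c by rewrite sumr_const card_ord mulr_natl.
  rewrite -big_split /= (bigD1 j) //= diag gerDl.
  by apply: sumr_le0 => k; rewrite eq_sym => /offdiag.
have : \sum_(j < n) (\sum_(k < n) a j k + n%:R * c) <= \sum_(j < n) (d + c).
  by apply: ler_sum => j _; exact: row.
rewrite big_split /= !sumr_const card_ord => total.
have : (n%:R * c) *+ n <= (d + c) *+ n.
  by apply: le_trans total; rewrite lerDr.
by rewrite lerMn2r gtn_eqF.
Qed.

(* [phi] is a total function, but only its values on [-1, 1] matter: the
   points [f j (tau k)] of the double sum lie in [-1, 1]. *)
Theorem theorem2p8 (R : realType) (M : metricType R) (o : M) (n : nat)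
    (hn : (1 <= n)%N) (theta : R) (htheta : 0 <= theta < 2 * pi)
    (f : 'I_n -> M -> R) (tau : 'I_n -> M)
    (hcode : metric_code o theta f tau)
    (c : R) (hc : 0 < c) (phi : R -> R)
    (hphi_sum : 0 <= \sum_(j < n) \sum_(k < n) phi (f j (tau k)))
    (hphi_le : forall r : R, -1 <= r <= cos theta -> phi r + c <= 0) :
  n%:R <= (phi 1 + c) / c
  /\ (phi 1 + c <= 1 -> n%:R <= 1 / c).
Proof.
have nc : n%:R * c <= phi 1 + c.
  apply: (sum_diag_dominated hn hphi_sum) => [j|j k /eqP jk].
    by rewrite (metric_code_diag hcode).
  apply: hphi_le; rewrite (metric_code_ge_opp1 hcode).
  exact: (metric_code_offdiag hcode).
by split=> [|phi1]; rewrite ler_pdivlMr // (le_trans nc).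
Qed.
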